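(* Let $\{G_t(x)\}_{t\ge 0}$ be one of the following polynomial sequences: Fibonacci, Lucas, Jacobsthal, Jacobsthal-Lucas, Chebyshev of the first kind, Pell-Lucas, or either of the two Morgan-Voyce sequences. Let $a_1,a_2,a_3$ and $b_1,b_2,b_3$ be the vertices of a star of David in the Hosoya polynomial triangle of $\{G_t(x)\}$, in configuration (a) or (b), such that the diagonal coordinates of $a_2$ are not $(0,0)$. Then $$\gcd(a_1,a_2,a_3)=\gcd(b_1,b_2,b_3).$$
   Context: Each sequence is given by $G_0=p_0$, $G_1=p_1$, $G_n=d\,G_{n-1}+g\,G_{n-2}$ for $n\ge 2$ in $\mathbb{Z}[x]$, with $(p_0,p_1,d,g)$ as follows. Fibonacci: $(0,1,x,1)$. Lucas: $(2,x,x,1)$. Jacobsthal: $(0,1,1,2x)$. Jacobsthal-Lucas: $(2,1,1,2x)$. Chebyshev of the first kind: $(1,x,2x,-1)$. Pell-Lucas (normalized, ''Pell-Lucas-prime''): $(1,x,2x,1)$. Morgan-Voyce $B$: $(0,1,x+2,-1)$. Morgan-Voyce $C$: $(2,x+2,x+2,-1)$. All gcds are taken in $\mathbb{Z}[x]$ and equalities of gcds are up to sign. The Hosoya polynomial triangle of $\{G_t(x)\}$ is the triangular array whose $k$-th entry ($0\le k\le r$) in row $r\ge0$ is $G_k(x)G_{r-k}(x)$; the point $G_m(x)G_n(x)$ has diagonal coordinates $(m,n)$. A star of David is one of the following. Configuration (a), with $m\ge 0$, $n\ge 2$: $a_1=G_{m+1}G_{n-2}$, $a_2=G_mG_n$,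 $a_3=G_{m+2}G_{n-1}$, $b_1=G_mG_{n-1}$, $b_2=G_{m+2}G_{n-2}$, $b_3=G_{m+1}G_n$. Configuration (b), with $m\ge 2$, $n\ge 2$: $a_1=G_mG_{n-1}$, $a_2=G_{m-2}G_{n-2}$, $a_3=G_{m-1}G_n$, $b_1=G_{m-1}G_{n-2}$, $b_2=G_mG_n$, $b_3=G_{m-2}G_{n-1}$. *)

(* Defs.v *)
From HB Require Import structures.
From mathcomp Require Import all_boot all_order all_algebra.
Set Implicit Arguments.
Unset Strict Implicit.
Unset Printing Implicit Defensive.
Import GRing.Theory.
Local Open Scope ring_scope.

Fixpoint gfp (p0 p1 d g : {poly int}) (n : nat) : {poly int} :=
  match n with
  | 0 => p0
  | k.+1 => match k with
            | 0 => p1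
            | l.+1 => d * gfp p0 p1 d g k + g * gfp p0 p1 d g l
            end
  end.

(* PellLucas is the normalized sequence (1, x, 2x, 1), half the classical
   one. *)
Inductive gfp_family : Type :=
  | Fibonacci | Lucas | Jacobsthal | JacobsthalLucas
  | ChebyshevT | PellLucas | MorganVoyceB | MorganVoyceC.

Definition gfp_of (F : gfp_family) : nat -> {poly int} :=
  match F with
  | Fibonacci       => gfp 0 1        'X       1
  | Lucas           => gfp 2 'X       'X       1
  | Jacobsthal      => gfp 0 1        1        (2 * 'X)
  | JacobsthalLucas => gfp 2 1        1        (2 * 'X)
  | ChebyshevT      => gfp 1 'X       (2 * 'X) (-1)
  | PellLucas       => gfp 1 'X       (2 * 'X) 1
  | MorganVoyceB    => gfp 0 1        ('X + 2) (-1)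
  | MorganVoyceC    => gfp 2 ('X + 2) ('X + 2) (-1)
  end.

(* Entry k of row r; meaningful for k <= r. *)
Definition hosoya (G : nat -> {poly int}) (r k : nat) : {poly int} :=
  G k * G (r - k)%N.

(* The point with diagonal coordinates c = (m, n) is entry m of row m + n,
   i.e. G m * G n. *)
Definition hosoya_pt (G : nat -> {poly int}) (c : nat * nat) : {poly int} :=
  hosoya G (c.1 + c.2)%N c.1.

(* Diagonal coordinates of the six vertices. *)
Record hexagon : Type := Hexagon {
  va1 : nat * nat; va2 : nat * nat; va3 : nat * nat;
  vb1 : nat * nat; vb2 : nat * nat; vb3 : nat * nat }.

Inductive star_of_david : hexagon -> Prop :=
  | star_a (m n : nat) of (2 <= n)%N :
      star_of_david
        (Hexagon (m + 1, n - 2) (m, n)     (m + 2, n - 1)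
                 (m, n - 1)     (m + 2, n - 2) (m + 1, n))%N
  | star_b (m n : nat) of (2 <= m)%N & (2 <= n)%N :
      star_of_david
        (Hexagon (m, n - 1)     (m - 2, n - 2) (m - 1, n)
                 (m - 1, n - 2) (m, n)     (m - 2, n - 1))%N.

(* Divisibility in Z[x] itself: the library's %| on {poly int} is
   pseudo-divisibility, for which 2 divides 'X. For the same reason gcdp is
   not the gcd of Z[x]. *)
Definition dvdZX (p q : {poly int}) : Prop := exists r, q = r * p.

Definition is_gcd3 (p q r d : {poly int}) : Prop :=
  [/\ dvdZX d p, dvdZX d q, dvdZX d r &
      forall e, dvdZX e p -> dvdZX e q -> dvdZX e r -> dvdZX e d].

(* gcd(p, q, r) = gcd(p', q', r') up to sign, a gcd being determined only up
   to the units 1 and -1 of Z[x]; existence of both gcds is part of the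
   claim. *)
Definition eq_gcd3 (p q r p' q' r' : {poly int}) : Prop :=
  [/\ exists d, is_gcd3 p q r d,
      exists d', is_gcd3 p' q' r' d' &
      forall d d', is_gcd3 p q r d -> is_gcd3 p' q' r' d' ->
        d = d' \/ d = - d'].

(* Main.v *)
Require Import Defs.
From HB Require Import structures.
From mathcomp Require Import all_boot all_order all_algebra.
From mathcomp Require Import ring zify.

(** Both gcds are equal, up to sign, to one and the same explicit polynomial.

    Each of the eight sequences has a polynomial q, one of 1, x and x + 2,
    such that consecutive terms are coprime, a common divisor of two terms at
    distance two divides q, and, if q is not 1, q divides exactly the terms
    whose index has a given parity, with multiplicity one as long as the index
    is positive.  The reason is that d is q or 2q: a common divisor of G_n and
    G_{n+2} divides d G_{n+1}, hence d, and the factor 2 is excluded because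
    no term of the sequences with d = 2x shares a factor with 2.  Multiplicity
    one comes from computing modulo q^2, where the terms of the right parity
    are q times an integer that grows linearly with the index, up to sign
    (gfp_mod_sqr).  The two Jacobsthal sequences have d = 1, hence q = 1.

    Write A, A', A'' for the terms at m, m+1, m+2 and B, B', B'' for those at
    the other coordinate.  Each triangle of a star consists of A' times one
    of B, B''; of B' times one of A, A''; and of one of A, A'' times one of
    B, B''.  Coprimality of neighbours shows that a common divisor is coprime
    to A' and B' (star_middle), that it divides q^2 (dvdZX_sqr), and finally
    that it divides q, or 1 when the parities do not both allow q
    (star_sequence_gcd).  The common divisor divides one of A, A'' and one of
    B, B''; the last step needs one of these two terms to have positive index,
    so that q^2 does not divide it.  Both have index 0 only in the star with
    a_2 at (0, 0).

    These arguments only need that Z[x] has gcds and hence satisfies Euclid's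
    lemma, which follows from Gauss's lemma on contents. *)

Set Implicit Arguments.
Unset Strict Implicit.
Unset Printing Implicit Defensive.
Import GRing.Theory.
Local Open Scope ring_scope.

(** * Divisibility in Z[x] *)

Lemma dvdZX_refl p : dvdZX p p.
Proof. by exists 1; rewrite mul1r. Qed.

Lemma dvdZX_trans p q r : dvdZX p q -> dvdZX q r -> dvdZX p r.
Proof. by move=> [u ->] [v ->]; exists (v * u); rewrite mulrA. Qed.

Lemma dvdZX_mull p q r : dvdZX p r -> dvdZX p (q * r).
Proof. by move=> [u ->]; exists (q * u); rewrite mulrA. Qed.

Lemma dvdZX_mulr p q r : dvdZX p q -> dvdZX p (q * r).
Proof. by rewrite mulrC; apply: dvdZX_mull. Qed.

Lemma dvdZX_mul p q r s : dvdZX p q -> dvdZX r s -> dvdZX (p * r) (q * s).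
Proof. by move=> [u ->] [v ->]; exists (u * v); rewrite mulrACA. Qed.

Lemma dvdZX_sub p q r : dvdZX p q -> dvdZX p r -> dvdZX p (q - r).
Proof. by move=> [u ->] [v ->]; exists (u - v); rewrite mulrBl. Qed.

Lemma dvdZX_addKr p q r : dvdZX p q -> dvdZX p (q + r) -> dvdZX p r.
Proof.
by move=> pq pqr; have := dvdZX_sub pqr pq; rewrite addrC addKr.
Qed.

Lemma dvdZX_addKl p q r : dvdZX p r -> dvdZX p (q + r) -> dvdZX p q.
Proof. by rewrite addrC; apply: dvdZX_addKr. Qed.

Lemma dvdZX1 p : dvdZX 1 p.
Proof. by exists p; rewrite mulr1. Qed.

Lemma dvdZX0 p : dvdZX p 0.
Proof. by exists 0; rewrite mul0r. Qed.

Lemma dvdZX_mul2r r p q : r != 0 -> dvdZX (p * r) (q * r) -> dvdZX p q.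
Proof.
by move=> r0 [u]; rewrite mulrA => /(mulIf r0) ->; exists u.
Qed.

(** Gauss's lemma, in the form that splits divisibility in Z[x] into
    divisibility in Z of the contents and divisibility in Q[x], which is what
    pseudo-divisibility amounts to. *)
Lemma dvdZXP p q :
  dvdZX p q <-> (zcontents p %| zcontents q)%Z /\ p %| q.
Proof.
split=> [[r ->]|[/dvdzP[k qk] /dvdpP_int[r qr]]].
  by rewrite zcontentsM dvdp_mull // dvdz_mull.
have [p0|p0] := eqVneq p 0.
  by rewrite qr p0 zprimitive0 mul0r; apply: dvdZX0.
move: qk; rewrite qr zcontentsM zcontents_primitive p0 mul1r => rk.
exists (k *: zprimitive r).
rewrite [in LHS](zpolyEprim r) rk [in RHS](zpolyEprim p).
by rewrite -!mul_polyC polyCM; ring.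
Qed.

(** The gcd has the gcd of the contents as content and the gcd over Q[x] as
    primitive part. *)
Lemma gcdZX_exists p q : exists f, [/\ dvdZX f p, dvdZX f q &
  forall e, dvdZX e p -> dvdZX e q -> dvdZX e f].
Proof.
have [/andP[/eqP-> /eqP->]|npq] := boolP ((p == 0) && (q == 0)).
  by exists 0; split=> *; apply: dvdZX0.
set c := gcdz (zcontents p) (zcontents q).
have c0 : c != 0 by rewrite gcdz_eq0 !zcontents_eq0.
set h := gcdp p q.
have h0 : h != 0 by rewrite gcdp_eq0.
have hE r : (r %| zprimitive h) = (r %| h).
  by rewrite [in RHS](zpolyEprim h) dvdpZr ?zcontents_eq0.
have Eh r : (zprimitive h %| r) = (h %| r).
  by rewrite [in RHS](zpolyEprim h) dvdpZl ?zcontents_eq0.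
have ch : zcontents (c *: zprimitive h) = c.
  by rewrite zcontentsZ zcontents_primitive h0 mulr1.
exists (c *: zprimitive h); split=> [||e /dvdZXP[ep1 ep2] /dvdZXP[eq1 eq2]].
- by apply/dvdZXP; rewrite ch dvdz_gcdl dvdpZl // Eh dvdp_gcdl.
- by apply/dvdZXP; rewrite ch dvdz_gcdr dvdpZl // Eh dvdp_gcdr.
- by apply/dvdZXP; rewrite ch dvdz_gcd ep1 eq1 dvdpZr // hE dvdp_gcd ep2.
Qed.

(** Associate elements are equal up to sign, the units of Z[x] being 1 and
    -1. *)
Lemma dvdZX_antisym p q : dvdZX p q -> dvdZX q p -> p = q \/ p = - q.
Proof.
move=> [r qE] [s pE]; have [q0|q0] := eqVneq q 0.
  by left; rewrite pE q0 mulr0.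
have /(mulIf q0) rs : (r * s) * q = 1 * q by rewrite mul1r -mulrA -pE.
have : s \is a GRing.unit.
  by apply/unitrP; exists r; rewrite [s * r]mulrC rs.
rewrite poly_unitE => /andP[/eqP/eq_leq/size1_polyC sE].
case/orP=> /eqP s0; rewrite pE sE s0; first by left; rewrite mul1r.
by right; rewrite polyCN mulN1r.
Qed.

(** * Coprime elements of Z[x] *)

Definition coprimeZX p q := forall e, dvdZX e p -> dvdZX e q -> dvdZX e 1.

Lemma coprimeZX_sym p q : coprimeZX p q -> coprimeZX q p.
Proof. by move=> pq e eq ep; apply: pq. Qed.

Lemma coprimeZX_dvdl p p' q : dvdZX p' p -> coprimeZX p q -> coprimeZX p' q.
Proof. by move=> p'p pq e ep'; apply: pq; apply: dvdZX_trans p'p. Qed.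

Lemma coprimeZX_1l p : coprimeZX 1 p.
Proof. by move=> e. Qed.

(** Euclid's lemma: r * gcd(p, q) is a gcd of p * r and q * r. *)
Lemma euclidZX p q r : coprimeZX p q -> dvdZX p (q * r) -> dvdZX p r.
Proof.
move=> cpq pqr; have [->|r0] := eqVneq r 0; first exact: dvdZX0.
have [f [fpr fqr fmax]] := gcdZX_exists (p * r) (q * r).
have pf : dvdZX p f by apply: fmax => //; apply/dvdZX_mulr/dvdZX_refl.
have [t ft] : dvdZX r f by apply: fmax; apply/dvdZX_mull/dvdZX_refl.
rewrite {f}ft in fpr fqr fmax pf.
have t1 : dvdZX t 1 by apply: cpq; apply: (dvdZX_mul2r r0).
apply: dvdZX_trans pf _; rewrite -[X in dvdZX _ X]mul1r.
by apply: dvdZX_mul => //; apply: dvdZX_refl.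
Qed.

Lemma coprimeZX_mulr p q r :
  coprimeZX p q -> coprimeZX p r -> coprimeZX p (q * r).
Proof.
move=> pq pr e ep /euclidZX er; apply: pr => //; apply: er.
exact: coprimeZX_dvdl ep pq.
Qed.

(** Splitting off a gcd takes the place of factoring into primes below. *)
Lemma gcdZX_split p q : exists f p' q',
  [/\ p = f * p', q = f * q' & coprimeZX p' q'].
Proof.
have [/andP[/eqP-> /eqP->]|npq] := boolP ((p == 0) && (q == 0)).
  by exists 0, 1, 1; rewrite !mul0r; split=> //; apply: coprimeZX_1l.
have [f [[p' pE] [q' qE] fmax]] := gcdZX_exists p q.
exists f, p', q'; split; rewrite 1?mulrC // => e ep' eq'.
have f0 : f != 0.
  by apply: contraNneq npq => f0; rewrite pE qE f0 !mulr0 !eqxx.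
apply: (dvdZX_mul2r f0); rewrite mul1r; apply: fmax.
  by rewrite pE; apply: dvdZX_mul => //; apply: dvdZX_refl.
by rewrite qE; apply: dvdZX_mul => //; apply: dvdZX_refl.
Qed.

(** A nonzero integer and a monic polynomial are coprime: a common divisor is
    constant, hence divides the leading coefficient 1. *)
Lemma coprimeZX_monic_const q (c : int) :
  q \is monic -> c != 0 -> coprimeZX q c%:P.
Proof.
move=> qm c0 e [s qE] [r cE].
have : (size (r * e)%R <= 1)%N by rewrite -cE size_polyC c0.
have re0 : r * e != 0 by rewrite -cE polyC_eq0.
have [r0 e0] : r != 0 /\ e != 0.
  by split; apply: contraNneq re0 => ->; rewrite ?mul0r ?mulr0.
rewrite size_mul // => re1.
have : (size e <= 1)%N.
  move: r0 re1; rewrite -size_poly_gt0; case: (size r) => // k _.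
  by rewrite addSn; apply: leq_trans (leq_addl _ _).
move=> /size1_polyC eE; exists (lead_coef s)%:P.
move/monicP: qm; rewrite qE lead_coefM {1}eE lead_coefC => se1.
by rewrite eE -polyCM se1.
Qed.

(** * The gcd of three products in a star *)

(** An element e dividing the three products is coprime to M: what it shares
    with M is coprime to X0 and X2, hence divides N and Y2, which are coprime.
    In the same way it is coprime to N. *)
Lemma star_middle M X0 X2 N Y0 Y2 e :
  coprimeZX M X0 -> coprimeZX M X2 -> coprimeZX N Y0 -> coprimeZX N Y2 ->
  dvdZX e (M * Y0) -> dvdZX e (X0 * Y2) -> dvdZX e (X2 * N) ->
  dvdZX e Y0 /\ dvdZX e X2.
Proof.
move=> MX0 MX2 NY0 NY2 e1 e2 e3.
have eM : coprimeZX e M.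
  move=> f fe fM; apply: NY2.
    by apply: euclidZX (coprimeZX_dvdl fM MX2) (dvdZX_trans fe e3).
  by apply: euclidZX (coprimeZX_dvdl fM MX0) (dvdZX_trans fe e2).
have eN : coprimeZX e N.
  move=> f fe fN; apply: MX0.
    rewrite mulrC in e1.
    by apply: euclidZX (coprimeZX_dvdl fN NY0) (dvdZX_trans fe e1).
  rewrite mulrC in e2.
  by apply: euclidZX (coprimeZX_dvdl fN NY2) (dvdZX_trans fe e2).
split; first exact: euclidZX eM e1.
by rewrite mulrC in e3; apply: euclidZX eN e3.
Qed.

(** Split off from e what it shares with X0: the split part divides q because
    X2 is a multiple of it too, and the rest divides Y2 and Y0, hence q. *)
Lemma dvdZX_sqr q X0 X2 Y0 Y2 e :
  (forall f, dvdZX f X0 -> dvdZX f X2 -> dvdZX f q) ->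
  (forall f, dvdZX f Y0 -> dvdZX f Y2 -> dvdZX f q) ->
  dvdZX e Y0 -> dvdZX e X2 -> dvdZX e (X0 * Y2) -> dvdZX e (q * q).
Proof.
move=> Xq Yq eY0 eX2 eXY.
have [f [e' [x [eE xE e'x]]]] := gcdZX_split e X0.
have fe : dvdZX f e by exists e'; rewrite eE mulrC.
have e'e : dvdZX e' e by exists f.
have fq : dvdZX f q.
  by apply: Xq; [exists x; rewrite xE mulrC | apply: dvdZX_trans eX2].
have [f0|f0] := eqVneq f 0.
  by move: fq; rewrite f0 => -[r ->]; rewrite !mulr0; apply: dvdZX0.
rewrite eE; apply: dvdZX_mul => //.
apply: Yq; first exact: dvdZX_trans eY0.
apply: euclidZX e'x _; apply: (dvdZX_mul2r f0).
by rewrite mulrC -eE mulrAC [x * f]mulrC -xE.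
Qed.

(** This is where multiplicity one enters: gcd(q * q, q * r) = q * gcd(q, r).
    It excludes a common divisor q * q. *)
Lemma dvdZX_coprime_factor q r e :
  coprimeZX q r -> dvdZX e (q * q) -> dvdZX e (q * r) -> dvdZX e q.
Proof.
move=> qr eqq eqr; have [f [e' [q' [eE qE e'q']]]] := gcdZX_split e q.
have [f0|f0] := eqVneq f 0.
  by rewrite qE f0 mul0r; apply: dvdZX0.
have cancel p : dvdZX e (q * p) -> dvdZX e' p.
  move=> eqp; apply: (euclidZX e'q'); apply: (dvdZX_mul2r f0).
  by rewrite mulrC -eE mulrAC [q' * f]mulrC -qE.
have e'1 : dvdZX e' 1 by apply: qr; apply: cancel.
rewrite eE qE; apply: dvdZX_mul; first exact: dvdZX_refl.
exact: dvdZX_trans e'1 (dvdZX1 _).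
Qed.

(** What the star needs to know of the sequence: there is a single polynomial
    q that neighbours at distance two can share; it divides the terms whose
    index has a given parity, and for positive index the cofactor is prime to q.
    At index 0 it may be 0. *)
Record star_sequence (G : nat -> {poly int}) (q : {poly int}) (b : bool) :
    Prop := StarSequence {
  star_adjacent n : coprimeZX (G n) (G n.+1);
  star_distance2 n e : dvdZX e (G n) -> dvdZX e (G n.+2) -> dvdZX e q;
  star_factor n : odd n = b ->
    exists2 r, G n = q * r & (0 < n)%N -> coprimeZX q r
}.

(** The next term is a multiple of q and is coprime to this one. *)
Lemma star_sequence_coprime G q b n :
  star_sequence G q b -> odd n != b -> coprimeZX q (G n).
Proof.
move=> hG nb; have [|r GE _] := star_factor hG (n := n.+1).
  by move: nb => /=; case: (odd n) b {hG} => [] [].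
apply: (@coprimeZX_dvdl (G n.+1)); first by exists r; rewrite GE mulrC.
by apply/coprimeZX_sym/(star_adjacent hG).
Qed.

Definition neighbours k i j := (i, j) = (k, k.+2) \/ (i, j) = (k.+2, k).

(** The middle indices are k + 1 and l + 1. Letting (i0, i2) and (j0, j2) be
    either ordering of the outer indices covers the four triangles of the two
    configurations at once. A common divisor divides q * q as well as G i2 and
    G j0. When both are multiples of q, positivity of i2 or j0 gives one that
    contains q only once; otherwise one of them is coprime to q. *)
Lemma star_sequence_gcd G q b k l i0 i2 j0 j2 :
  star_sequence G q b ->
  neighbours k i0 i2 -> neighbours l j0 j2 -> (0 < i2 + j0)%N ->
  is_gcd3 (G k.+1 * G j0) (G i0 * G j2) (G i2 * G l.+1)
    (if (odd k == b) && (odd l == b) then q else 1).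
Proof.
move=> hG nk nl pos.
have adj n i j : neighbours n i j -> coprimeZX (G n.+1) (G i) /\
    coprimeZX (G n.+1) (G j) /\ odd i = odd n /\ odd j = odd n.
  have lo : coprimeZX (G n.+1) (G n) by apply/coprimeZX_sym/(star_adjacent hG).
  have hi := star_adjacent hG (n := n.+1).
  by case=> [[-> ->]|[-> ->]]; rewrite /= !negbK.
have dist n i j : neighbours n i j ->
    forall f, dvdZX f (G i) -> dvdZX f (G j) -> dvdZX f q.
  have d2 := star_distance2 hG (n := n).
  by case=> [[-> ->]|[-> ->]] f fi fj; apply: d2.
have [ki0 [ki2 [oi0 oi2]]] := adj _ _ _ nk.
have [lj0 [lj2 [oj0 oj2]]] := adj _ _ _ nl.
have Xq := dist _ _ _ nk; have Yq := dist _ _ _ nl.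
have reduce e : dvdZX e (G k.+1 * G j0) -> dvdZX e (G i0 * G j2) ->
    dvdZX e (G i2 * G l.+1) ->
    [/\ dvdZX e (G j0), dvdZX e (G i2) & dvdZX e (q * q)].
  move=> e1 e2 e3.
  have [eY eX] := star_middle ki0 ki2 lj0 lj2 e1 e2 e3.
  by split=> //; apply: dvdZX_sqr eY eX e2.
have [/andP[/eqP kb /eqP lb]|nb] := boolP (_ && _).
  have [i0b i2b] : odd i0 = b /\ odd i2 = b by rewrite oi0 oi2.
  have j0b : odd j0 = b by rewrite oj0.
  have [r0 i0E _] := star_factor hG i0b.
  have [r2 i2E ci2] := star_factor hG i2b.
  have [s0 j0E cj0] := star_factor hG j0b.
  split; first by exists (G k.+1 * s0); rewrite j0E; ring.
  - by exists (r0 * G j2); rewrite i0E; ring.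
  - by exists (r2 * G l.+1); rewrite i2E; ring.
  move=> e e1 e2 e3; have [ej0 ei2 eqq] := reduce e e1 e2 e3.
  move: pos; rewrite addn_gt0 => /orP[/ci2 c|/cj0 c].
    by apply: dvdZX_coprime_factor c eqq _; rewrite -i2E.
  by apply: dvdZX_coprime_factor c eqq _; rewrite -j0E.
split; try exact: dvdZX1.
move=> e e1 e2 e3; have [ej0 ei2 eqq] := reduce e e1 e2 e3.
move: nb; rewrite negb_and => /orP[kb|lb].
  have c : coprimeZX (G i2) q.
    by apply/coprimeZX_sym/(star_sequence_coprime hG); rewrite oi2.
  exact: (coprimeZX_mulr c c) ei2 eqq.
have c : coprimeZX (G j0) q.
  by apply/coprimeZX_sym/(star_sequence_coprime hG); rewrite oj0.
exact: (coprimeZX_mulr c c) ej0 eqq.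
Qed.

Lemma is_gcd3_rev p q r d : is_gcd3 p q r d -> is_gcd3 r q p d.
Proof. by case=> dp dq dr dmax; split=> // e er eq ep; apply: dmax. Qed.

Lemma is_gcd3_unique p q r d d' :
  is_gcd3 p q r d -> is_gcd3 p q r d' -> d = d' \/ d = - d'.
Proof.
move=> [dp dq dr dmax] [dp' dq' dr' dmax'].
by apply: dvdZX_antisym; [apply: dmax' | apply: dmax].
Qed.

Lemma is_gcd3_transfer p q r p' q' r' d d' :
  is_gcd3 p q r d -> is_gcd3 p' q' r' d -> is_gcd3 p q r d' ->
  is_gcd3 p' q' r' d'.
Proof.
move=> [dp dq dr dmax] [dp' dq' dr' dmax'] [ep eq er emax].
have d'd : dvdZX d' d by apply: dmax.
have dd' : dvdZX d d' by apply: emax.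
split; try exact: dvdZX_trans d'd _.
by move=> e e1 e2 e3; apply: dvdZX_trans dd'; apply: dmax'.
Qed.

Lemma eq_gcd3_common p q r p' q' r' d :
  is_gcd3 p q r d -> is_gcd3 p' q' r' d -> eq_gcd3 p q r p' q' r'.
Proof.
move=> hd hd'; split; [by exists d | by exists d |].
move=> e e' he; apply: is_gcd3_unique.
exact: is_gcd3_transfer hd hd' he.
Qed.

Lemma star_sequence_eq_gcd3 G q b (s : hexagon) :
  star_sequence G q b -> star_of_david s -> va2 s <> (0%N, 0%N) ->
  let H := hosoya_pt G in
  eq_gcd3 (H (va1 s)) (H (va2 s)) (H (va3 s))
          (H (vb1 s)) (H (vb2 s)) (H (vb3 s)).
Proof.
move=> hG sD a2; rewrite /hosoya_pt /hosoya.
have up k : neighbours k k k.+2 by left.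
have down k : neighbours k k.+2 k by right.
case: {s} sD a2 => [m [//|[//|n]] _ _|[//|[//|m]] [//|[//|n]] _ _ a2] /=;
  rewrite ?addn1 ?addn2 ?subn1 ?subn2 /= ![(_ + _ - _)%N]addKn.
  apply: eq_gcd3_common (star_sequence_gcd hG (up m) (up n) _) _ => //.
  by apply/is_gcd3_rev/(star_sequence_gcd hG (down m) (down n)); lia.
apply: eq_gcd3_common (is_gcd3_rev (star_sequence_gcd hG (up m) (down n) _)) _.
  by [].
apply: (star_sequence_gcd hG (down m) (up n)).
by case: m n a2 => [|m] [|n].
Qed.

(** * The recurrence *)

Lemma gfp_coprime_adjacent p0 p1 d g n :
  coprimeZX p0 p1 -> (forall k, coprimeZX (gfp p0 p1 d g k.+1) g) ->
  coprimeZX (gfp p0 p1 d g n) (gfp p0 p1 d g n.+1).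
Proof.
move=> p01 Gg; elim: n => [//|n IH] e e1 /=; rewrite -/(gfp p0 p1 d g n.+1).
move=> /(dvdZX_addKr (dvdZX_mull _ e1)).
by move=> /(euclidZX (coprimeZX_dvdl e1 (Gg n))) /IH; apply.
Qed.

(** Modulo c the recurrence relates terms at distance two by the unit g. *)
Lemma gfp_coprime_divisor c p0 p1 d (g : {poly int}) n :
  g * g = 1 -> dvdZX c d -> coprimeZX c p0 -> coprimeZX c p1 ->
  coprimeZX c (gfp p0 p1 d g n).
Proof.
move=> gg cd c0 c1.
suff [] : coprimeZX c (gfp p0 p1 d g n) /\ coprimeZX c (gfp p0 p1 d g n.+1).
  by [].
elim: n => [//|n [IH IH1]]; split=> // e ec /=.
rewrite -/(gfp p0 p1 d g n.+1).
move=> /(dvdZX_addKr (dvdZX_mulr _ (dvdZX_trans ec cd))) /(dvdZX_mull g).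
by rewrite mulrA gg mul1r; apply: IH.
Qed.

(** Along the parity class b, the terms are q times something that, modulo q,
    is an integer growing linearly, up to sign. The terms in between are
    constant modulo q, up to sign, and d being a multiple of q they
    contribute the increment. *)
Lemma gfp_mod_sqr p0 p1 q (c s a u : int) v (b : nat) k :
  s * s = 1 ->
  let G := gfp p0 p1 (c%:P * q) s%:P in
  G b = q * a%:P -> G b.+1 = u%:P + q * v ->
  exists r t,
    G (b + k.*2)%N = q * ((s ^+ k * (a + k%:Z * (c * u * s)))%:P + q * r) /\
    G (b + k.*2).+1 = (s ^+ k * u)%:P + q * t.
Proof.
move=> ss G Gb Gb1; elim: k => [|k [r [t [IH IH1]]]].
  exists 0, v; rewrite addn0 Gb Gb1; split; last by rewrite expr0 mul1r.
  by rewrite expr0 mul1r mul0r !addr0 mulr0 addr0.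
have step n : G n.+2 = c%:P * q * G n.+1 + s%:P * G n by [].
have GE : G (b + k.+1.*2)%N =
    q * ((s ^+ k.+1 * (a + k.+1%:Z * (c * u * s)))%:P +
         q * (c%:P * t + s%:P * r)).
  rewrite doubleS !addnS step IH IH1.
  have -> : s ^+ k.+1 * (a + k.+1%:Z * (c * u * s)) =
      s ^+ k * (c * u) * (s * s) + s * (s ^+ k * (a + k%:Z * (c * u * s))).
    by rewrite exprS intS; ring.
  by rewrite ss mulr1 !rmorphD /= !rmorphM /=; ring.
exists (c%:P * t + s%:P * r).
exists (c%:P * G (b + k.+1.*2)%N + s%:P * t); split=> //.
rewrite !doubleS !addnS step IH1.
by rewrite exprS !rmorphM /=; ring.
Qed.

(** The parameters a and u are values modulo q: a of the quotient by q of the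
    first term in the parity class b, and u of the term after it. *)
Lemma gfp_star_sequence q (c s a u : int) v (b : bool) p0 p1 d g :
  q \is monic -> s * s = 1 -> d = c%:P * q -> g = s%:P ->
  coprimeZX p0 p1 -> coprimeZX c%:P p0 -> coprimeZX c%:P p1 ->
  let G := gfp p0 p1 d g in
  G b = q * a%:P -> G b.+1 = u%:P + q * v ->
  (forall k, (0 < b + k.*2)%N -> a + k%:Z * (c * u * s) != 0) ->
  star_sequence G q b.
Proof.
move=> qm ss -> -> p01 c0 c1 G Gb Gb1 nz.
have gg : s%:P * s%:P = 1 :> {poly int} by rewrite -polyCM ss.
have adj n : coprimeZX (G n) (G n.+1).
  apply: gfp_coprime_adjacent => // k; apply: coprimeZX_sym.
  by apply: coprimeZX_dvdl (@coprimeZX_1l _); exists s%:P.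
split=> // [n e en en2 | n nb].
  have : dvdZX e (c%:P * q * G n.+1).
    by apply: dvdZX_addKl en2; apply: dvdZX_mull.
  rewrite mulrC => /(euclidZX (coprimeZX_dvdl en (adj n))).
  apply: euclidZX; apply: coprimeZX_dvdl en _; apply: coprimeZX_sym.
  by apply: gfp_coprime_divisor => //; exists q; rewrite mulrC.
have nE : n = (b + n./2.*2)%N by rewrite -nb odd_double_half.
have [r [t [GE _]]] := gfp_mod_sqr n./2 ss Gb Gb1.
rewrite -/G -nE in GE.
set z := s ^+ _ * _ in GE.
exists (z%:P + q * r) => // n0.
have z0 : z != 0.
  rewrite mulf_neq0 ?nz -?nE // expf_neq0 //.
  by apply/eqP => s0; move: ss; rewrite s0.
move=> e eq /(dvdZX_addKl (dvdZX_mulr _ eq)).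
exact: (coprimeZX_monic_const qm z0) eq.
Qed.

(** Here neighbours at distance two are coprime because d is 1, and
    consecutive terms are coprime because all terms but the first are 1
    modulo g. *)
Lemma gfp_star_sequence_d1 p0 g b :
  coprimeZX p0 1 -> star_sequence (gfp p0 1 1 g) 1 b.
Proof.
move=> p01; set G := gfp p0 1 1 g.
have step n : G n.+2 = 1 * G n.+1 + g * G n by [].
have Gg n : coprimeZX (G n.+1) g.
  elim: n => [|n IH] e; first by move=> e1 _.
  rewrite step mul1r => eG eg; apply: IH (eg).
  by apply: dvdZX_addKl eG; apply: dvdZX_mulr.
have adj n : coprimeZX (G n) (G n.+1) by apply: gfp_coprime_adjacent.
split=> // [n e en en2 | n _].
  apply: adj (en) _; rewrite step mul1r in en2.
  by apply: dvdZX_addKl en2; apply: dvdZX_mull.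
by exists (G n); rewrite ?mul1r // => _; apply: coprimeZX_1l.
Qed.

(** For q other than 1, the integers a + k c u s of gfp_mod_sqr are k or -k
    when G_0 = 0 and 2k + 1 in the other cases, so they vanish at most at
    index 0. *)
Lemma gfp_of_star_sequence F : exists q b, star_sequence (gfp_of F) q b.
Proof.
have XD2 : 'X + 2 \is @monic int.
  by rewrite -[2 : {poly int}]opprK -polyC_natr -polyCN monicXsubC.
have C2 : (2 : int)%:P = 2 by rewrite -polyC_natr.
have co2q q : q \is @monic int -> coprimeZX 2 q.
  by move=> qm; apply/coprimeZX_sym; rewrite -C2; apply: coprimeZX_monic_const.
have X1 := monicX int.
case: F => /=.
- exists 'X, false.
  apply: (@gfp_star_sequence 'X 1 1 0 1 0); rewrite ?mul1r //=; try ring.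
  by case=> //; lia.
- exists 'X, true.
  apply: (@gfp_star_sequence 'X 1 1 1 2 'X); rewrite ?mul1r ?C2 //=; try ring.
    exact: co2q.
- by exists 1, true; apply: gfp_star_sequence_d1.
- by exists 1, true; apply: gfp_star_sequence_d1.
- exists 'X, true.
  apply: (@gfp_star_sequence 'X 2 (-1) 1 (-1) (2 * 'X));
    rewrite ?C2 //=; try ring.
    exact: co2q.
- exists 'X, true.
  apply: (@gfp_star_sequence 'X 2 1 1 1 (2 * 'X));
    rewrite ?C2 //=; try ring.
    exact: co2q.
- exists ('X + 2), false.
  apply: (@gfp_star_sequence _ 1 (-1) 0 1 0);
    rewrite ?mul1r //=; try ring.
  by case=> //; lia.
- exists ('X + 2), true.
  apply: (@gfp_star_sequence _ 1 (-1) 1 (-2) ('X + 2));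
    rewrite ?C2 ?mul1r //=; try ring.
    exact: co2q.
Qed.

Theorem corollary6 (F : gfp_family) (s : hexagon) :
  star_of_david s -> va2 s <> (0%N, 0%N) ->
  let H := hosoya_pt (gfp_of F) in
  eq_gcd3 (H (va1 s)) (H (va2 s)) (H (va3 s))
          (H (vb1 s)) (H (vb2 s)) (H (vb3 s)).
Proof.
have [q [b hG]] := gfp_of_star_sequence F.
exact: star_sequence_eq_gcd3 hG.
Qed.
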